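(* Let $(X,T,d)$ be a topological dynamical system. For all $0<\theta<1$, $$\overline{\mathrm{mdim}}_{\mathrm M}(X,T,d)\le\mathrm{mdim}_{\mathrm A}^{\theta}(X,T,d)\le\min\left\{\frac{\overline{\mathrm{mdim}}_{\mathrm M}(X,T,d)}{1-\theta},\ \mathrm{mdim}_{\mathrm A}(X,T,d)\right\}.$$
   Context: A topological dynamical system $(X,T,d)$ is a compact metric space $(X,d)$ with a homeomorphism $T:X\to X$. For $M\in\mathbb N=\{1,2,\dots\}$ put $d_M(x,y)=\max_{0\le m<M}d(T^mx,T^my)$ and $B_{d_M}(x,r)=\{y\in X: d_M(x,y)\le r\}$. For a metric $d$, a subset $K$ and $\varepsilon>0$, $N_d(K,\varepsilon)$ is the minimal $n\ge1$ such that $K$ can be covered by $n$ open sets of $d$-diameter at most $\varepsilon$. For $0<\rho<r$ let $$S(X,r,\rho)=\lim_{M\to\infty}\frac1M\sup_{x\in X}\log N_{d_M}(B_{d_M}(x,r),\rho)$$ (the limit exists by sub-additivity). The mean Assouad dimension is $$\mathrm{mdim}_{\mathrm A}(X,T,d)=\inf\{s>0:\exists C>0\ \forall\, 0<\rho<r,\ e^{S(X,r,\rho)}\le C(r/\rho)^s\},$$ and for $\theta\in(0,1)$ the mean Assouad spectrum is $$\mathrm{mdim}_{\mathrm A}^\theta(X,T,d)=\inf\{s>0:\exists C>0\ \forall\, 0<r<1,\ e^{S(X,r,r^{1/\theta})}\le C(r/r^{1/\theta})^s\}$$ (with $\inf\emptyset=+\infty$). The upper metric mean dimension is $$\overline{\mathrm{mdim}}_{\mathrm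 M}(X,T,d)=\limsup_{\varepsilon\to0}\lim_{M\to\infty}\frac{\log N_{d_M}(X,\varepsilon)}{M\log(1/\varepsilon)}.$$ All quantities take values in $[0,+\infty]$. *)

(* Defs.v *)
From mathcomp Require Export all_boot all_order all_algebra.
From mathcomp Require Export all_classical all_reals all_analysis.

Export Order.TTheory GRing.Theory Num.Theory.
Export numFieldNormedType.Exports.

#[export] Set Implicit Arguments.
#[export] Unset Strict Implicit.
#[export] Unset Printing Implicit Defensive.

Local Open Scope classical_set_scope.
Local Open Scope ring_scope.
Local Open Scope ereal_scope.

Definition homeomorphism (X Y : topologicalType) (f : X -> Y) : Prop :=
  continuous f /\
  exists g : Y -> X, [/\ continuous g, cancel f g & cancel g f].

Section MeanDimensions.
Context {R : realType} {X : metricType R}.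

(* As distances are nonnegative, the default value 0 of the iterated maximum
   only matters for M = 0, where dyn_dist T 0 is constantly 0. *)
Definition dyn_dist (T : X -> X) (M : nat) (x y : X) : R :=
  (\big[Num.max/0]_(m < M) mdist (iter m T x) (iter m T y))%R.

(* The distance d need not be that of X (it will be [dyn_dist T M]), whence an
   explicit argument in the next three definitions. *)
Definition dist_cball (d : X -> X -> R) (x : X) (r : R) : set X :=
  [set y | (d x y <= r)%R].

Definition diam (d : X -> X -> R) (U : set X) : \bar R :=
  ereal_sup [set (d x y)%:E | x in U & y in U].

(* "Open" refers to the topology of X, which is also the topology of each
   [dyn_dist T M] with M > 0 when T is continuous. The infimum of a nonempty
   set of integers is its minimum; it is +oo when no finite cover exists. *)
Definition cover_num (d : X -> X -> R) (K : set X) (eps : R) : \bar R :=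
  ereal_inf [set n%:R%:E | n in [set n : nat | (1 <= n)%N /\
    exists U : 'I_n -> set X,
      [/\ forall i, open (U i),
          forall i, diam d (U i) <= eps%:E
        & K `<=` \bigcup_i U i]]].

(* The terms of index M = 0 in this limit and in [umdimM] carry no meaning and
   do not affect the limits. *)
Definition local_entropy (T : X -> X) (r rho : R) : \bar R :=
  limn (fun M : nat => (M%:R^-1)%:E *
    ereal_sup [set lne (cover_num (dyn_dist T M)
                          (dist_cball (dyn_dist T M) x r) rho)
              | x in [set: X]]).

Definition mdimA (T : X -> X) : \bar R :=
  ereal_inf [set s%:E | s in [set s : R | (0 < s)%R /\
    exists2 C : R, (0 < C)%R &
      forall r rho : R, (0 < rho)%R -> (rho < r)%R ->
        expeR (local_entropy T r rho) <= (C * (r / rho) `^ s)%:E]].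

Definition mdimA_spectrum (theta : R) (T : X -> X) : \bar R :=
  ereal_inf [set s%:E | s in [set s : R | (0 < s)%R /\
    exists2 C : R, (0 < C)%R &
      forall r : R, (0 < r)%R -> (r < 1)%R ->
        expeR (local_entropy T r (r `^ theta^-1)) <=
          (C * (r / r `^ theta^-1) `^ s)%:E]].

Definition umdimM (T : X -> X) : \bar R :=
  limf_esup (fun eps : R => limn (fun M : nat =>
    lne (cover_num (dyn_dist T M) [set: X] eps) /
      (M%:R * ln eps^-1)%:E)) (0%R : R)^'+.

End MeanDimensions.

(* Main.v *)
Require Import Defs.
From mathcomp Require Import ring.

(** Write H(eps) for the exponential growth rate in M of N_{d_M}(X, eps), and
S(r, rho) for that of the largest covering number at scale rho of a d_M-ball of
radius r. Three facts on covering numbers carry everything.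

- Both rates are genuine limits. Covers of the first M steps and of the next N
  steps of the orbits intersect to a cover for M + N steps
  ([coverable_dynD]), so the logarithms of the covering numbers are subadditive
  in M and Fekete's lemma ([cvg_mean_rate]) applies. Finiteness comes from
  compactness ([coverable_mdist]).

- S(r, rho) <= H(rho), as a ball is part of X ([local_rate_le]).

- H(rho) <= H(r) + S(r, rho): cover X by sets of diameter at most r, put each
  of them in the ball of radius r around one of its points, and cover that ball
  at scale rho ([global_rate_le]).

For the bound of the upper metric mean dimension by the spectrum, let s be
admissible for the spectrum and set g(L) = H(e^-L), a = 1/theta. The third fact
at r = e^-L and rho = r^a reads g(a L) <= g(L) + c + s (a - 1) L. For s' > s the
constant c is absorbed at large L, so that g(L) - s' L does not increase under
L -> a L; since g is monotone this gives g(L) <= K + s' L for all large L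
([affine_bound_dilation]), i.e. H(eps) <= K + s' log(1/eps).

For the converse bound, let u exceed the upper metric mean dimension. The second
fact gives S(r, r^a) <= H(r^a) <= (u/theta) log(1/r) for small r, and
u/theta = (u/(1 - theta)) (a - 1), so u/(1 - theta) is admissible for the
spectrum ([spectrum_le_of_umdimM_lt]). The bound of the spectrum by the mean
Assouad dimension is the specialization rho = r^a. *)

Local Open Scope classical_set_scope.
Local Open Scope ring_scope.

(** * Finite open covers by sets of small diameter *)

Section Coverable.
Context {R : realType} {X : metricType R}.
Implicit Types (d : X -> X -> R) (K U : set X) (T : X -> X).

Definition coverable d K (eps : R) (n : nat) : Prop :=
  (1 <= n)%N /\ exists U : 'I_n -> set X,
    [/\ forall i, open (U i), forall i, (diam d (U i) <= eps%:E)%E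
      & K `<=` \bigcup_i U i].

Lemma diam_leP d U (eps : R) :
  (diam d U <= eps%:E)%E <-> forall x y, U x -> U y -> d x y <= eps.
Proof.
split=> [h x y Ux Uy|h].
  rewrite -lee_fin; apply: le_trans h.
  by apply: ereal_sup_ubound; exists x => //; exists y.
by apply: ge_ereal_sup => _ [x Ux [y Uy <-]]; rewrite lee_fin h.
Qed.

(** Covers arise below indexed by sums and products of ordinals; allowing any
finite index type leaves the re-indexing to [enum_val]. *)
Lemma coverable_fin (I : finType) d K eps (U : I -> set X) :
  (0 < #|I|)%N -> (forall i, open (U i)) ->
  (forall i x y, U i x -> U i y -> d x y <= eps) ->
  K `<=` \bigcup_i U i -> coverable d K eps #|I|.
Proof.
move=> I0 oU dU KU; split=> //; exists (U \o enum_val); split=> [i|i|x /KU].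
- exact: oU.
- by apply/diam_leP; exact: dU.
- by case=> i _ Uix; exists (enum_rank i) => //=; rewrite enum_rankK.
Qed.

Lemma coverableP d K eps n : coverable d K eps n <->
  (1 <= n)%N /\ exists U : 'I_n -> set X,
    [/\ forall i, open (U i), forall i x y, U i x -> U i y -> d x y <= eps
      & K `<=` \bigcup_i U i].
Proof.
split=> -[n0 [U [oU dU KU]]]; split=> //; exists U; split=> // i.
  exact/diam_leP.
by apply/diam_leP; exact: dU.
Qed.

Lemma coverable_sub d K K' eps eps' n : K' `<=` K -> eps <= eps' ->
  coverable d K eps n -> coverable d K' eps' n.
Proof.
move=> K'K ee' /coverableP[n0 [U [oU dU KU]]]; apply/coverableP; split=> //.
exists U; split=> // [i x y Ux Uy|x /K'K/KU//].
by rewrite (le_trans (dU i x y Ux Uy)).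
Qed.

Lemma coverable_leq d K eps m n : (m <= n)%N ->
  coverable d K eps m -> coverable d K eps n.
Proof.
move=> mn /coverableP[m0 [U [oU dU KU]]]; apply/coverableP.
split; first exact: leq_trans mn.
exists (fun i => if insub (val i) is Some j then U j else set0); split.
- by move=> i; case: insub => [j|]; [exact: oU|exact: open0].
- by move=> i x y; case: insub => [j|//]; exact: dU.
- move=> x /KU[i _ Uix]; exists (widen_ord mn i) => //=.
  by case: insubP => [j _ /val_inj->//|]; rewrite ltn_ord.
Qed.

Lemma coverable_setU d K L eps m n :
  coverable d K eps m -> coverable d L eps n ->
  coverable d (K `|` L) eps (m + n).
Proof.
move=> /coverableP[m0 [U [oU dU KU]]] /coverableP[n0 [V [oV dV LV]]].
have -> : (m + n = #|{: 'I_m + 'I_n}|)%N by rewrite card_sum !card_ord.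
apply: (@coverable_fin _ _ _ _
  (fun i => match i with inl j => U j | inr j => V j end)).
- by rewrite card_sum !card_ord addn_gt0 m0.
- by case.
- by case.
- move=> x [/KU[i _ Ux]|/LV[i _ Vx]]; first by exists (inl i).
  by exists (inr i).
Qed.

(** A set of diameter at most r lies in the closed ball of radius r around any of
its points, so a cover at scale r is refined ball by ball. *)
Lemma coverable_balls d K r rho m n : (1 <= n)%N -> coverable d K r m ->
  (forall x, coverable d (dist_cball d x r) rho n) ->
  coverable d K rho (m * n).
Proof.
move=> n0 /coverableP[m0 [U [oU dU KU]]] cB.
have cU i : exists V : 'I_n -> set X, [/\ forall j, open (V j),
    forall j x y, V j x -> V j y -> d x y <= rho & U i `<=` \bigcup_j V j].
  have [[x Ux]|U0] := pselect (exists x, U i x).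
    have /coverableP[_ [V [oV dV BV]]] := cB x.
    by exists V; split=> // y Uy; apply: BV; exact: dU Ux Uy.
  exists (fun=> set0); split=> // [_|y Uy]; first exact: open0.
  by case: U0; exists y.
have [V VP] := choice cU.
have mnE : (m * n = #|{: 'I_m * 'I_n}|)%N by rewrite card_prod !card_ord.
rewrite mnE; apply: (@coverable_fin _ _ _ _ (fun ij => V ij.1 ij.2)).
- by rewrite -mnE muln_gt0 m0.
- by move=> [i j] /=; have [oV _ _] := VP i.
- by move=> [i j] /=; have [_ dV _] := VP i; exact: dV.
- move=> x /KU[i _ Ux]; have [_ _ /(_ x Ux)[j _ Vx]] := VP i.
  by exists (i, j).
Qed.

End Coverable.

(** * Covers along orbits *)

Section BowenDistance.
Context {R : realType} {X : metricType R}.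
Implicit Types (K L : set X) (T : X -> X).

Lemma dyn_dist_leP T M x y (r : R) : 0 <= r ->
  dyn_dist T M x y <= r <->
  forall m, (m < M)%N -> mdist (iter m T x) (iter m T y) <= r.
Proof.
move=> r0; split=> [/bigmax_leP[_ h] m mM|h]; first exact: (h (Ordinal mM)).
by apply/bigmax_leP; split=> // i _; exact: h.
Qed.

Lemma dyn_distD_leP T M N x y (r : R) : 0 <= r ->
  dyn_dist T (M + N) x y <= r <->
  dyn_dist T M x y <= r /\ dyn_dist T N (iter M T x) (iter M T y) <= r.
Proof.
move=> r0; split=> [/(dyn_dist_leP _ _ _ _ r0) h|[]].
  split; apply/dyn_dist_leP => // m mM; first by apply: h; rewrite ltn_addr.
  by rewrite -!iterD addnC; apply: h; rewrite ltn_add2l.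
move=> /(dyn_dist_leP _ _ _ _ r0) h1 /(dyn_dist_leP _ _ _ _ r0) h2.
apply/dyn_dist_leP => // m mMN; have [/h1//|Mm] := ltnP m M.
by have := h2 (m - M)%N; rewrite -!iterD subnK// => -> //; rewrite ltn_subLR.
Qed.

(** Two points of U `&` iter M T @^-1` V are close during the first M steps by U
and during the next N steps by V. *)
Lemma coverable_dynD T M N K L (eps : R) m n : continuous T -> 0 <= eps ->
  coverable (dyn_dist T M) K eps m -> coverable (dyn_dist T N) L eps n ->
  coverable (dyn_dist T (M + N)) (K `&` iter M T @^-1` L) eps (m * n).
Proof.
move=> cT e0 /coverableP[m0 [U [oU dU KU]]] /coverableP[n0 [V [oV dV LV]]].
have cTM : continuous (iter M T).
  by elim: M {dU} => [|M IH] x //=; apply: continuous_comp; [exact: IH|exact: cT].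
have mnE : (m * n = #|{: 'I_m * 'I_n}|)%N by rewrite card_prod !card_ord.
rewrite mnE.
apply: (@coverable_fin _ _ _ _ _ _ (fun ij => U ij.1 `&` iter M T @^-1` V ij.2)).
- by rewrite -mnE muln_gt0 m0.
- move=> [i j] /=; apply: openI; first exact: oU.
  by apply: open_comp => // x _; exact: cTM.
- move=> [i j] x y [/= Ux Vx] [/= Uy Vy].
  by apply/dyn_distD_leP => //; split; [exact: dU Ux Uy|exact: dV Vx Vy].
- move=> x [/KU[i _ Ux] /LV[j _ Vx]]; by exists (i, j).
Qed.

(** If X had no finite cover at scale eps, the complements of the finitely
coverable sets would form a proper filter. A cluster point x of it is
impossible, as the ball of radius eps / 2 around x is itself coverable. *)
Lemma coverable_mdist (eps : R) : compact [set: X] -> 0 < eps ->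
  exists n, coverable (@mdist R X) setT eps n.
Proof.
move=> cX e0; apply: contrapT => ncov.
pose F (A : set X) := exists n, coverable (@mdist R X) (~` A) eps n.
have FF : ProperFilter F.
  split; first by rewrite /F setC0.
  split.
  - exists 1%N; apply/coverableP; split=> //; exists (fun=> set0).
    by split=> // [_|x]; [exact: open0|rewrite setCT].
  - move=> A B [m mA] [n nB]; exists (m + n)%N; rewrite setCI.
    exact: coverable_setU.
  - move=> A B AB [m mA]; exists m; apply: coverable_sub mA => //.
    exact: subsetC.
have FT : F setT by exact: filterT.
have [x [_ xF]] := cX _ FF FT.
have e20 : 0 < eps / 2 by rewrite divr_gt0.
pose V := (ball x (eps / 2))°.
have Vx : V x by exact: nbhsx_ballx.
have FV : F (~` V).
  exists 1%N; apply/coverableP; split=> //; exists (fun=> V); split.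
  - by move=> _; exact: open_interior.
  - move=> _ y z /interior_subset By /interior_subset Bz.
    move: By Bz; rewrite !ballEmdist/= => By Bz.
    rewrite (le_trans (metric_triangle y x z))// metric_sym.
    by rewrite (splitr eps) lerD// ltW.
  - by move=> y; rewrite setCK => Vy; exists ord0.
have nV : nbhs x V by apply: open_nbhs_nbhs; split => //; exact: open_interior.
by have [y [nVy Vy]] := xF _ _ FV nV.
Qed.

Lemma coverable_dyn T M (eps : R) : compact [set: X] -> continuous T ->
  0 < eps -> exists n, coverable (dyn_dist T M) setT eps n.
Proof.
move=> cX cT e0; elim: M => [|M [n nM]].
  exists 1%N; apply/coverableP; split=> //; exists (fun=> setT); split=> //.
  - by move=> _; exact: openT.
  - by move=> _ x y _ _; rewrite dyn_dist_leP// ltW.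
  - by move=> x _; exists ord0.
have [p cp] := coverable_mdist cX e0.
have c1 : coverable (dyn_dist T 1) setT eps p.
  suff -> : dyn_dist T 1 = @mdist R X by [].
  apply/funext => x; apply/funext => y.
  rewrite /dyn_dist big_ord_recl big_ord0 /=; apply/max_idPl; exact: mdist_ge0.
have := coverable_dynD cT (ltW e0) nM c1.
by rewrite preimage_setT setIT addn1 => h; exists (n * p)%N.
Qed.

End BowenDistance.

(** * Fekete's lemma for nonnegative sequences *)

Section Fekete.
Context {R : realType}.
Implicit Types a b c : nat -> R.

Definition mean_rate a : R := inf [set a n / n%:R | n in [set n | (0 < n)%N]].

(** With a k / k close to the infimum, division n = q k + r gives
a n <= q a k + B for a constant B bounding a on the remainders. *)
Lemma cvg_mean_rate a : (forall n, 0 <= a n) ->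
  (forall m n, a (m + n)%N <= a m + a n) ->
  a n / n%:R @[n --> \oo] --> mean_rate a.
Proof.
move=> a0 aD.
have lb : has_lbound [set a n / n%:R | n in [set n | (0 < n)%N]].
  by exists 0 => _ [n _ <-]; rewrite divr_ge0.
apply/cvgrPdist_le => e e0.
have e20 : 0 < e / 2 by rewrite divr_gt0.
have [_ [k k0 <-] ake] : exists2 x,
    [set a n / n%:R | n in [set n | (0 < n)%N]] x & x < mean_rate a + e / 2.
  by apply: inf_adherent => //; split=> //; exists (a 1%N / 1%:R), 1%N.
pose B := \sum_(i < k) a i.
have aB q r : (r < k)%N -> a (q * k + r)%N <= q%:R * a k + B.
  move=> rk; elim: q => [|q IH].
    rewrite mul0n mul0r !add0r /B (bigD1 (Ordinal rk)) //= lerDl.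
    exact: sumr_ge0.
  rewrite mulSn -addnA (le_trans (aD _ _))// -natr1 mulrDl mul1r.
  by rewrite addrAC [leRHS]addrC lerD.
near=> n.
have n0 : (0 < n)%N by near: n; exact: nbhs_infty_gt.
have nR : 0 < n%:R :> R by rewrite ltr0n.
have le1 : mean_rate a <= a n / n%:R by apply: ge_inf => //; exists n.
rewrite distrC ger0_norm ?subr_ge0// lerBlDl.
have Bn : B <= e / 2 * n%:R.
  rewrite mulrC -ler_pdivrMr //; near: n; exact: nbhs_infty_ger.
rewrite ler_pdivrMr // (divn_eq n k) (le_trans (aB _ _ (ltn_pmod _ k0)))//.
rewrite -divn_eq.
have kR : 0 < k%:R :> R by rewrite ltr0n.
have le2 : (n %/ k)%:R * a k <= (a k / k%:R) * n%:R.
  rewrite [leRHS]mulrAC -[X in X <= _](mulfK (lt0r_neq0 kR)) ler_pM2r ?invr_gt0//.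
  rewrite mulrAC mulrC ler_wpM2l// -natrM ler_nat; exact: leq_divM.
have le3 : (a k / k%:R) * n%:R <= (mean_rate a + e / 2) * n%:R.
  by rewrite ler_pM2r// ltW.
rewrite (splitr e) addrA [leRHS]mulrDl lerD//; exact: le_trans le3.
Unshelve. all: by end_near. Qed.

Lemma mean_rate_ge0 a : (forall n, 0 <= a n) -> 0 <= mean_rate a.
Proof.
move=> a0; apply: lb_le_inf; first by exists (a 1%N / 1%:R), 1%N.
by move=> _ [n _ <-]; rewrite divr_ge0.
Qed.

End Fekete.

(** * Covering numbers as natural numbers *)

Definition leastn (A : set nat) : nat :=
  get [set n | A n /\ forall m, A m -> (n <= m)%N].

Lemma leastnP (A : set nat) : A !=set0 ->
  A (leastn A) /\ forall m, A m -> (leastn A <= m)%N.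
Proof.
move=> [n An].
have exA : exists n, `[< A n >] by exists n; apply/asboolP.
apply: (@getPex _ [set n | A n /\ forall m, A m -> (n <= m)%N]).
case: (ex_minnP exA) => m /asboolP Am mA; exists m; split=> // k /asboolP.
exact: mA.
Qed.

Section CoveringEntropies.
Context {R : realType} {X : metricType R}.
Variable (T : X -> X).
Hypotheses (cX : compact [set: X]) (cT : continuous T).

Definition global_num (M : nat) (eps : R) : nat :=
  leastn (coverable (dyn_dist T M) setT eps).

(** Least number of sets that suffices for all balls of radius r at once. Its
logarithm is the supremum over x in the local entropy when X is nonempty, and
it inherits submultiplicativity directly from the covers. *)
Definition local_num (M : nat) (r rho : R) : nat :=
  leastn [set n | (1 <= n)%N /\
    forall x, coverable (dyn_dist T M) (dist_cball (dyn_dist T M) x r) rho n].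

Lemma cover_numE d (K : set X) eps : (exists n, coverable d K eps n) ->
  cover_num d K eps = ((leastn (coverable d K eps))%:R%:E)%E.
Proof.
move=> /leastnP[cov least]; apply/eqP; rewrite eq_le; apply/andP; split.
  by apply: ereal_inf_lbound; exists (leastn (coverable d K eps)).
apply: le_ereal_inf_tmp => _ [n cn <-]; rewrite lee_fin ler_nat.
exact: least.
Qed.

Lemma global_numP M eps : 0 < eps ->
  coverable (dyn_dist T M) setT eps (global_num M eps) /\
  forall n, coverable (dyn_dist T M) setT eps n -> (global_num M eps <= n)%N.
Proof. by move=> e0; apply: leastnP; exact: coverable_dyn. Qed.

Lemma global_num_gt0 M eps : 0 < eps -> (0 < global_num M eps)%N.
Proof. by move=> /(global_numP M)[[]]. Qed.

Lemma local_numP M r rho : 0 < rho ->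
  ((0 < local_num M r rho)%N /\ forall x, coverable (dyn_dist T M)
     (dist_cball (dyn_dist T M) x r) rho (local_num M r rho)) /\
  forall n, (0 < n)%N -> (forall x, coverable (dyn_dist T M)
     (dist_cball (dyn_dist T M) x r) rho n) -> (local_num M r rho <= n)%N.
Proof.
move=> rho0.
have [|? h] := @leastnP [set n | (1 <= n)%N /\
    forall x, coverable (dyn_dist T M) (dist_cball (dyn_dist T M) x r) rho n].
  have [n cn] := coverable_dyn M cX cT rho0.
  exists n; split; first by case: cn.
  by move=> x; apply: coverable_sub cn.
by split=> // n n0 cn; exact: h.
Qed.

Lemma global_numD M N eps : 0 < eps ->
  (global_num (M + N) eps <= global_num M eps * global_num N eps)%N.
Proof.
move=> e0; apply: (global_numP _ e0).2.
have := coverable_dynD cT (ltW e0) (global_numP M e0).1 (global_numP N e0).1.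
by rewrite preimage_setT setIT.
Qed.

(** A d_(M+N)-ball around x consists of points y in the d_M-ball around x such
that T^M y is in the d_N-ball around T^M x. *)
Lemma local_numD M N r rho : 0 < r -> 0 < rho ->
  (local_num (M + N) r rho <= local_num M r rho * local_num N r rho)%N.
Proof.
move=> r0 rho0; have [[P0 PM] _] := local_numP M r rho0.
have [[Q0 QN] _] := local_numP N r rho0.
apply: (local_numP _ _ rho0).2; first by rewrite muln_gt0 P0.
move=> x.
have := coverable_dynD cT (ltW rho0) (PM x) (QN (iter M T x)).
apply: coverable_sub => //.
by move=> y /(dyn_distD_leP _ _ _ _ _ (ltW r0)).
Qed.

Lemma local_num_le_global M r rho : 0 < rho ->
  (local_num M r rho <= global_num M rho)%N.
Proof.
move=> rho0; apply: (local_numP _ _ rho0).2; first exact: global_num_gt0.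
by move=> x; apply: coverable_sub (global_numP M rho0).1.
Qed.

Lemma global_num_le M r rho : 0 < r -> 0 < rho ->
  (global_num M rho <= global_num M r * local_num M r rho)%N.
Proof.
move=> r0 rho0; have [[P0 PM] _] := local_numP M r rho0.
apply: (global_numP _ rho0).2.
by apply: coverable_balls PM => //; exact: (global_numP M r0).1.
Qed.

Lemma global_num_anti M eps eps' : 0 < eps -> eps <= eps' ->
  (global_num M eps' <= global_num M eps)%N.
Proof.
move=> e0 ee'; apply: (global_numP _ (lt_le_trans e0 ee')).2.
by apply: coverable_sub (global_numP M e0).1.
Qed.

(** * Growth rates of the covering numbers *)

Definition global_rate (eps : R) : R :=
  mean_rate (fun M => ln (global_num M eps)%:R).

Definition local_rate (r rho : R) : R :=
  mean_rate (fun M => ln (local_num M r rho)%:R).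

Lemma ln_nat_le m n : (0 < m)%N -> (m <= n)%N -> ln m%:R <= ln n%:R :> R.
Proof. 
move=> m0 mn; rewrite ler_ln ?ler_nat// posrE ltr0n//; exact: leq_trans mn.
Qed.

Lemma ln_natM m n : (0 < m)%N -> (0 < n)%N ->
  ln (m * n)%:R = ln m%:R + ln n%:R :> R.
Proof. by move=> m0 n0; rewrite natrM lnM // posrE ltr0n. Qed.

Lemma ln_nat_ge0 n : 0 <= ln n%:R :> R.
Proof.
have [->|n0] := posnP n; first by rewrite ln0.
by apply: ln_ge0; rewrite ler1n.
Qed.

Lemma cvg_global_rate eps : 0 < eps ->
  ln (global_num M eps)%:R / M%:R @[M --> \oo] --> global_rate eps.
Proof.
move=> e0; apply: cvg_mean_rate => [n|m n /=]; first exact: ln_nat_ge0.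
by rewrite -ln_natM ?global_num_gt0// ln_nat_le ?global_num_gt0// global_numD.
Qed.

Lemma cvg_local_rate r rho : 0 < r -> 0 < rho ->
  ln (local_num M r rho)%:R / M%:R @[M --> \oo] --> local_rate r rho.
Proof.
move=> r0 rho0; have P0 M := (local_numP M r rho0).1.1.
apply: cvg_mean_rate => [n|m n /=]; first exact: ln_nat_ge0.
by rewrite -ln_natM// ln_nat_le// local_numD.
Qed.

Lemma global_rate_ge0 eps : 0 <= global_rate eps.
Proof. by apply: mean_rate_ge0 => n; exact: ln_nat_ge0. Qed.

Lemma global_rate_anti eps eps' : 0 < eps -> eps <= eps' ->
  global_rate eps' <= global_rate eps.
Proof.
move=> e0 ee'; have e'0 := lt_le_trans e0 ee'.
apply: ler_cvg_to (cvg_global_rate e'0) (cvg_global_rate e0) _.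
apply: nearW => M; rewrite ler_wpM2r// ln_nat_le ?global_num_gt0//.
exact: global_num_anti.
Qed.

Lemma local_rate_le r rho : 0 < r -> 0 < rho ->
  local_rate r rho <= global_rate rho.
Proof.
move=> r0 rho0.
apply: ler_cvg_to (cvg_local_rate r0 rho0) (cvg_global_rate rho0) _.
apply: nearW => M; rewrite ler_wpM2r// ln_nat_le ?local_num_le_global//.
exact: (local_numP M r rho0).1.1.
Qed.

Lemma global_rate_le r rho : 0 < r -> 0 < rho ->
  global_rate rho <= global_rate r + local_rate r rho.
Proof.
move=> r0 rho0.
apply: ler_cvg_to (cvg_global_rate rho0)
  (cvgD (cvg_global_rate r0) (cvg_local_rate r0 rho0)) _.
have P0 M := (local_numP M r rho0).1.1.
apply: nearW => M; rewrite -mulrDl ler_wpM2r// fctE -ln_natM ?global_num_gt0//.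
by rewrite ln_nat_le ?global_num_gt0// global_num_le.
Qed.

Local Open Scope ereal_scope.

Lemma umdimM_limE eps : (0 < eps < 1)%R ->
  limn (fun M => lne (cover_num (dyn_dist T M) setT eps) /
    (M%:R * ln eps^-1)%:E) = (global_rate eps / ln eps^-1)%:E.
Proof.
move=> /andP[e0 e1].
have le0 : (0 < ln eps^-1)%R by rewrite ln_gt0// invf_gt1.
apply/cvg_lim => //.
have : ((ln (global_num M eps)%:R / M%:R / ln eps^-1)%:E @[M --> \oo] -->
    (global_rate eps / ln eps^-1)%:E).
  by apply: cvg_EFin; [exact: nearW|apply: cvgMr_tmp; exact: cvg_global_rate].
apply: cvg_trans; apply: near_eq_cvg; near=> M.
have M0 : (0 < M)%N by near: M; exact: nbhs_infty_gt.
rewrite cover_numE; last exact: coverable_dyn.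
rewrite -/(global_num M eps) lne_EFin ?ltr0n ?global_num_gt0//.
rewrite inver mulf_eq0 pnatr_eq0 -leqn0 leqNgt M0 (gt_eqF le0)/=.
by rewrite -EFinM invfM mulrA.
Unshelve. all: by end_near. Qed.

(** The point x0 excludes the empty space, where the supremum over x is that of
the empty set and the local entropy is -oo. *)
Lemma local_entropyE (x0 : X) r rho : (0 < r)%R -> (0 < rho)%R ->
  local_entropy T r rho = (local_rate r rho)%:E.
Proof.
move=> r0 rho0; apply/cvg_lim => //.
have : ((ln (local_num M r rho)%:R / M%:R)%:E @[M --> \oo] -->
    (local_rate r rho)%:E).
  by apply: cvg_EFin; [exact: nearW|exact: cvg_local_rate].
apply: cvg_trans; apply: near_eq_cvg; apply: nearW => M /=.
rewrite mulrC EFinM; congr (_ * _).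
have [[P0 PM] least] := local_numP M r rho0.
have cE x := @cover_numE (dyn_dist T M) (dist_cball (dyn_dist T M) x r) rho
  (ex_intro _ _ (PM x)).
have cP x := leastnP (ex_intro _ _ (PM x)).
have lnE x : lne (cover_num (dyn_dist T M) (dist_cball (dyn_dist T M) x r) rho)
    = (ln (leastn (coverable (dyn_dist T M)
            (dist_cball (dyn_dist T M) x r) rho))%:R)%:E.
  by rewrite cE lne_EFin// ltr0n; case: (cP x).1.
apply/eqP; rewrite eq_le; apply/andP; split; last first.
  apply: ge_ereal_sup => _ [x _ <-]; rewrite lnE lee_fin ln_nat_le//.
    by case: (cP x).1.
  exact: ((cP x).2 _ (PM x)).
(* Some ball needs all of the [local_num M r rho] sets: otherwise one set less
   would suffice for every ball. *)
have [x xP] : exists x, (local_num M r rho <= leastn (coverable (dyn_dist T M)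
            (dist_cball (dyn_dist T M) x r) rho))%N.
  apply: contrapT => /forallNP small.
  have P1 : (1 < local_num M r rho)%N.
    have [[l0 _] _] := cP x0; have /negP := small x0.
    by rewrite -ltnNge; exact: leq_ltn_trans.
  have : (local_num M r rho <= (local_num M r rho).-1)%N.
    apply: least => [|x]; first by rewrite -ltnS prednK.
    apply: coverable_leq (cP x).1.
    by rewrite -ltnS prednK// ltnNge; apply/negP; exact: small.
  by rewrite -ltnS prednK// ltnn.
apply: (@le_trans _ _ (lne (cover_num (dyn_dist T M)
  (dist_cball (dyn_dist T M) x r) rho))).
  by rewrite lnE lee_fin ln_nat_le.
by apply: ereal_sup_ubound; exists x.
Qed.

End CoveringEntropies.

(** * Iterating a growth inequality along dilations *)

Section SelfImprovement.
Context {R : realType}.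

Lemma expr_unbounded (a x : R) : 1 < a -> exists k, x <= a ^+ k.
Proof.
move=> a1.
have bern k : k%:R * (a - 1) <= a ^+ k.
  elim: k => [|k IH]; first by rewrite mul0r.
  rewrite -natr1 mulrDl mul1r exprS.
  have ak1 : 1 <= a ^+ k by rewrite exprn_ege1// ltW.
  rewrite -[X in _ <= X * _](subrK 1 a) mulrDl mul1r addrC lerD//.
  by rewrite ler_peMr// subr_ge0 ltW.
exists (Num.bound `|x / (a - 1)|); apply: le_trans (bern _).
rewrite -ler_pdivrMr ?subr_gt0//; apply: le_trans (ler_norm _) _.
exact/ltW/archi_boundP.
Qed.

(** For L >= L0 the slack (s' - s) (a - 1) L exceeds c, so g(L) - s' L does not
increase under L -> a L. Dividing L by a until it lands in [L0, a L0] bounds this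
quantity by the value of g at the right end. Absorbing c in s' makes the bound
independent of the number of divisions. *)
Lemma affine_bound_dilation (g : R -> R) (a c s s' : R) :
  1 < a -> 0 <= s' -> s < s' ->
  (forall L L', 0 < L -> L <= L' -> g L <= g L') ->
  (forall L, 0 < L -> g (a * L) <= g L + (c + s * ((a - 1) * L))) ->
  exists L0 K, 0 < L0 /\ forall L, L0 <= L -> g L <= K + s' * L.
Proof.
move=> a1 s'0 ss' mono dil.
have a0 : 0 < a by rewrite (lt_trans _ a1).
have D0 : 0 < (s' - s) * (a - 1) by rewrite mulr_gt0 ?subr_gt0.
pose L0 := `|c| / ((s' - s) * (a - 1)) + 1.
have L0_gt0 : 0 < L0 by rewrite ltr_wpDl// divr_ge0// ltW.
have step L : L0 <= L -> g (a * L) <= g L + s' * ((a - 1) * L).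
  move=> L0L; apply: le_trans (dil _ (lt_le_trans L0_gt0 L0L)) _.
  rewrite lerD2l -lerBrDr -mulrBl mulrA.
  apply: le_trans (ler_norm c) _; rewrite mulrC -ler_pdivrMr//.
  by apply: le_trans L0L; rewrite lerDl.
exists L0, (g (a * L0)); split=> // L L0L.
have [k Lk] := expr_unbounded (L / L0) a1.
move: Lk; rewrite ler_pdivrMr// => Lk.
elim: k L L0L Lk => [|k IH] L L0L Lk.
  have -> : L = L0 by apply/eqP; rewrite eq_le L0L andbT -[L0]mul1r.
  rewrite (@le_trans _ _ (g (a * L0)))//; first by rewrite mono// ler_peMl// ltW.
  by rewrite lerDl mulr_ge0// ltW.
have [LaL0|aL0L] := leP L (a * L0).
  rewrite (@le_trans _ _ (g (a * L0)))//.
    by rewrite mono// (lt_le_trans L0_gt0).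
  by rewrite lerDl mulr_ge0// (le_trans (ltW L0_gt0)).
have LE : L = a * (L / a) by rewrite mulrC divfK// gt_eqF.
have L0La : L0 <= L / a by rewrite ler_pdivlMr// mulrC ltW.
have /IH : L0 <= L / a by [].
rewrite ler_pdivrMr// mulrAC -exprSr => /(_ Lk) gLa.
rewrite {1}LE (le_trans (step _ L0La))//.
rewrite -lerBrDr (le_trans gLa)// lerBrDr -addrA lerD2l -mulrDr ler_wpM2l//.
by rewrite -[X in X + _]mul1r -mulrDl addrC subrK -LE.
Qed.

End SelfImprovement.

(** * Comparison of the mean dimensions *)

Section MeanDimensionEstimates.
Context {R : realType} {X : metricType R}.
Variable (T : X -> X).
Hypotheses (cX : compact [set: X]) (cT : continuous T).
Local Open Scope ereal_scope.

Lemma near0_lnV (x : R) : \forall eps \near (0%R : R)^'+,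
  [/\ (0 < eps)%R, (eps < 1)%R & (x <= ln eps^-1)%R].
Proof.
near=> eps.
have e0 : (0 < eps)%R by near: eps; exact: nbhs_right_gt.
split; [exact: e0|by near: eps; exact: nbhs_right_lt ltr01|].
rewrite lnV ?posrE// lerNr -[leRHS]expRK ler_ln ?posrE ?expR_gt0//.
by near: eps; apply: nbhs_right_le; exact: expR_gt0.
Unshelve. all: by end_near. Qed.

Lemma umdimM_le (u : R) :
  (\forall eps \near (0%R : R)^'+, (global_rate T eps <= u * ln eps^-1)%R) ->
  umdimM T <= u%:E.
Proof.
move=> gu; apply: ge_ereal_inf.
set f := fun eps : R => _.
exists (ereal_sup (f @` [set eps | f eps <= u%:E])).
  exists [set eps | f eps <= u%:E] => //.
  near=> eps.
  have [e0 e1 l1] : [/\ (0 < eps)%R, (eps < 1)%R & (1 <= ln eps^-1)%R].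
    by near: eps; exact: near0_lnV.
  rewrite /= /f umdimM_limE ?e0// lee_fin ler_pdivrMr ?(lt_le_trans _ l1)//.
  by near: eps; exact: gu.
by apply: ge_ereal_sup => _ [eps ? <-].
Unshelve. all: by end_near. Qed.

Lemma umdimM_lt (u : R) : umdimM T < u%:E ->
  \forall eps \near (0%R : R)^'+, (global_rate T eps <= u * ln eps^-1)%R.
Proof.
move=> /ereal_inf_lt[_ [V V0 <-]] Vu; near=> eps.
have [e0 e1 l1] : [/\ (0 < eps)%R, (eps < 1)%R & (1 <= ln eps^-1)%R].
  by near: eps; exact: near0_lnV.
rewrite -ler_pdivrMr ?(lt_le_trans _ l1)// -lee_fin -umdimM_limE ?e0//.
apply: le_trans (ltW Vu); apply: ereal_sup_ubound.
by exists eps => //; near: eps.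
Unshelve. all: by end_near. Qed.

Lemma umdimM_ge0 : 0 <= umdimM T.
Proof.
apply: le_ereal_inf_tmp => _ [V V0 <-].
have /filter_ex[eps [Ve [e0 e1 l0]]] :
    \forall eps \near (0%R : R)^'+, V eps /\
      [/\ (0 < eps)%R, (eps < 1)%R & (0 <= ln eps^-1)%R].
  by apply: filterI => //; exact: near0_lnV.
apply: le_ereal_sup_tmp; eexists; first by exists eps.
by rewrite umdimM_limE ?e0// lee_fin divr_ge0// global_rate_ge0.
Qed.

Lemma expeR_le_powR (y : \bar R) (C x s : R) : (0 < C)%R -> (0 < x)%R ->
  (expeR y <= (C * x `^ s)%:E) = (y <= (ln C + s * ln x)%:E).
Proof.
move=> C0 x0; rewrite -[RHS]lee_expeR /= expRD lnK ?posrE//.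
by rewrite /powR gt_eqF.
Qed.

Lemma ln_div_powR (r b : R) : (0 < r)%R ->
  ln (r / r `^ b) = ((b - 1) * ln r^-1)%R.
Proof.
move=> r0; rewrite ln_div ?posrE ?powR_gt0// ln_powR lnV ?posrE//.
by rewrite mulrN mulrBl mul1r opprB.
Qed.

Lemma local_entropy_le r rho : (0 < r)%R -> (0 < rho)%R ->
  local_entropy T r rho <= (global_rate T rho)%:E.
Proof.
move=> r0 rho0; have [[x0]|noX] := pselect (inhabited X).
  by rewrite (local_entropyE cX cT x0)// lee_fin local_rate_le.
rewrite /local_entropy (_ : limn _ = -oo) ?leNye//.
apply: lim_near_cst => //; near=> M.
have M0 : (0 < M)%N by near: M; exact: nbhs_infty_gt.
rewrite (_ : [set _ | _ in _] = set0) ?ereal_sup0 ?gt0_muleNy//.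
  by rewrite lte_fin invr_gt0 ltr0n.
by apply/seteqP; split=> // t [x _ _]; case: noX; exact: (inhabits x).
Unshelve. all: by end_near. Qed.

(** Covers at scale r^(1/theta) are obtained from covers at scale r by refining
balls; with L = log(1/r) this is a growth inequality of [affine_bound_dilation]
with dilation factor 1/theta. *)
Lemma umdimM_le_spectrum (theta : R) : (0 < theta)%R -> (theta < 1)%R ->
  umdimM T <= mdimA_spectrum theta T.
Proof.
move=> t0 t1; apply: le_ereal_inf_tmp => _ [s [s0 [C C0 hC]] <-].
(* On the empty space the local entropy is -oo and gives no information, but the
   global covering numbers are 1. *)
have [[x0]|noX] := pselect (inhabited X); last first.
  apply: (@le_trans _ _ 0); last by rewrite lee_fin ltW.
  apply: umdimM_le; near=> eps; rewrite mul0r.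
  have e0 : (0 < eps)%R by near: eps; exact: nbhs_right_gt.
  apply: (cvgr_to_le (cvg_global_rate cX cT e0)); apply: nearW => M.
  rewrite mulr_le0_ge0// ln_le0// lern1.
  apply: (global_numP cX cT M e0).2; apply/coverableP; split => //.
  exists (fun=> setT); split=> [_|_ x|x]; first exact: openT.
    by case: noX.
  by case: noX.
have a1 : (1 < theta^-1)%R by rewrite invf_gt1.
apply/lee_addgt0Pr => e e0.
have e20 : (0 < e / 2)%R by rewrite divr_gt0.
have mono L L' : (0 < L)%R -> (L <= L')%R ->
    (global_rate T (expR (- L)) <= global_rate T (expR (- L')))%R.
  by move=> _ LL'; apply: global_rate_anti => //;
    rewrite ?expR_gt0// ler_expR lerN2.
have dil L : (0 < L)%R -> (global_rate T (expR (- (theta^-1 * L))) <=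
    global_rate T (expR (- L)) + (ln C + s * ((theta^-1 - 1) * L)))%R.
  move=> L0; have r0 := expR_gt0 (- L)%R.
  have r1 : (expR (- L) < 1)%R by rewrite expR_lt1 oppr_lt0.
  have rhoE : (expR (- (theta^-1 * L)) = expR (- L) `^ theta^-1)%R.
    by rewrite /powR gt_eqF// expRK mulrN.
  have rho0 : (0 < expR (- L) `^ theta^-1)%R by rewrite powR_gt0.
  rewrite rhoE (le_trans (global_rate_le cX cT r0 rho0))// lerD2l.
  have := hC _ r0 r1; rewrite (local_entropyE cX cT x0)//.
  rewrite expeR_le_powR//; last first.
    by rewrite divr_gt0.
  by rewrite lee_fin ln_div_powR// lnV ?posrE// expRK opprK.
have ss' : (s < s + e / 2)%R by rewrite ltrDl.
have [L0 [K [L00 gK]]] := @affine_bound_dilation _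
  (fun L => global_rate T (expR (- L))) _ (ln C) s (s + e / 2) a1
  (ltW (addr_gt0 s0 e20)) ss' mono dil.
rewrite -EFinD; apply: umdimM_le; near=> eps.
have [e'0 _ L0L] : [/\ (0 < eps)%R, (eps < 1)%R & (L0 <= ln eps^-1)%R].
  by near: eps; exact: near0_lnV.
have [_ _ KL] : [/\ (0 < eps)%R, (eps < 1)%R & (K / (e / 2) <= ln eps^-1)%R].
  by near: eps; exact: near0_lnV.
have := gK _ L0L; rewrite /= lnV ?posrE// opprK lnK ?posrE// -lnV ?posrE//.
move=> /le_trans; apply.
rewrite -lerBrDr -mulrBl (_ : s + e - (s + e / 2) = e / 2)%R; last by field.
by rewrite mulrC -ler_pdivrMr.
Unshelve. all: by end_near. Qed.

Lemma spectrum_le_mdimA (theta : R) : (0 < theta)%R -> (theta < 1)%R ->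
  mdimA_spectrum theta T <= mdimA T.
Proof.
move=> t0 t1; apply: ereal_inf_le_tmp => _ [s [s0 [C C0 hC]] <-].
exists s => //; split=> //; exists C => // r r0 r1; apply: hC.
  by rewrite powR_gt0.
rewrite -ltr_ln ?posrE ?powR_gt0// ln_powR gtr_nMl ?invf_gt1//.
by rewrite ln_lt0// r0.
Qed.

(** The hypothesis on u controls the local entropy only when r^(1/theta) is small.
For larger r the multiplicative constant expR K suffices, K being the global
rate at one fixed small scale, as (r / r^(1/theta))^s >= 1 for r < 1. *)
Lemma spectrum_le_of_umdimM_lt (theta u : R) : (0 < theta)%R -> (theta < 1)%R ->
  (0 < u)%R -> umdimM T < u%:E ->
  mdimA_spectrum theta T <= (u / (1 - theta))%:E.
Proof.
move=> t0 t1 u0 /umdimM_lt/nbhs_ballP[d /= d0 hd].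
have hd' rho : (0 < rho)%R -> (rho < d)%R ->
    (global_rate T rho <= u * ln rho^-1)%R.
  by move=> rho0 rhod; apply: hd => //; rewrite /ball/= sub0r normrN gtr0_norm.
have d20 : (0 < d / 2)%R by rewrite divr_gt0.
pose K := global_rate T (d / 2).
apply: ereal_inf_lbound; exists (u / (1 - theta))%R => //; split.
  by rewrite divr_gt0// subr_gt0.
exists (expR K) => [|r r0 r1]; first exact: expR_gt0.
have rho0 : (0 < r `^ theta^-1)%R by rewrite powR_gt0.
rewrite expeR_le_powR ?expR_gt0 ?divr_gt0//.
apply: le_trans (local_entropy_le r0 rho0) _.
rewrite lee_fin expRK ln_div_powR//.
(* The exponent u / (1 - theta) turns r / r^(1/theta) into r^(-u/theta). *)
have -> : (u / (1 - theta) * ((theta^-1 - 1) * ln r^-1) =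
    u * ln (r `^ theta^-1)^-1)%R.
  rewrite !lnV ?posrE// ln_powR mulrA -mulrN mulrA; congr (_ * _)%R.
  by field; rewrite subr_eq0 !gt_eqF.
have [rd|dr] := ltP (r `^ theta^-1)%R d.
  by rewrite (le_trans (hd' _ rho0 rd))// lerDr global_rate_ge0.
rewrite (@le_trans _ _ K)//.
  apply: global_rate_anti => //.
  by rewrite (le_trans _ dr)// ler_pdivrMr// ler_peMr ?ler1n// ltW.
rewrite lerDl mulr_ge0// ?(ltW u0)// ln_ge0// invf_ge1//.
rewrite -ler_ln ?posrE// ln1 ln_powR mulr_ge0_le0 ?invr_ge0 ?(ltW t0)//.
by rewrite ln_le0// ltW.
Qed.

Lemma spectrum_le_umdimM (theta : R) : (0 < theta)%R -> (theta < 1)%R ->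
  mdimA_spectrum theta T <= umdimM T / (1 - theta)%:E.
Proof.
move=> t0 t1; have t10 : (0 < 1 - theta)%R by rewrite subr_gt0.
rewrite inver gt_eqF//.
have := umdimM_ge0; case mE : (umdimM T) => [m| |] //; last first.
  by rewrite gt0_mulye ?leey// lte_fin invr_gt0.
rewrite lee_fin -EFinM => m0; apply/lee_addgt0Pr => e e0.
have ue : (0 < e * (1 - theta))%R by rewrite mulr_gt0.
apply: (le_trans (spectrum_le_of_umdimM_lt t0 t1 (ltr_wpDl m0 ue) _)).
  by rewrite mE lte_fin ltrDl.
by rewrite -EFinD mulrDl mulfK// gt_eqF.
Qed.

End MeanDimensionEstimates.

Local Open Scope ereal_scope.

Theorem proposition3p2 (R : realType) (X : metricType R) (T : X -> X)
    (hX : compact [set: X]) (hT : homeomorphism T)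
    (theta : R) (theta_gt0 : (0 < theta)%R) (theta_lt1 : (theta < 1)%R) :
  umdimM T <= mdimA_spectrum theta T /\
  mdimA_spectrum theta T <= mine (umdimM T / (1 - theta)%:E) (mdimA T).
Proof.
have cT : continuous T by case: hT.
split; first exact: umdimM_le_spectrum.
by rewrite le_min spectrum_le_umdimM ?spectrum_le_mdimA.
Qed.
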